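(* Let $G$ be a prime $(P_5,\overline{P_5})$-sparse graph. Then either $G$ is $C_5$-free (it has no induced subgraph isomorphic to $C_5$), or $G$ is isomorphic to $C_5$.
   Context: All graphs are finite, simple and undirected. $P_5$ is the chordless path on $5$ vertices, $\overline{P_5}$ is its complement (the ''house''), and $C_5$ is the chordless cycle on $5$ vertices. For a set $\mathcal{F}$ of graphs, all on $p$ vertices, a graph $G$ is called $\mathcal{F}$-sparse if every induced subgraph of $G$ on $p+1$ vertices contains at most one graph of $\mathcal{F}$ as an induced subgraph, i.e. for every set $S$ of $p+1$ vertices of $G$ there is at most one $p$-element subset of $S$ inducing a subgraph isomorphic to a member of $\mathcal{F}$. A graph is $(P_5,\overline{P_5})$-sparse if it is $\mathcal{F}$-sparse for $\mathcal{F}=\{P_5,\overline{P_5}\}$; thus every $6$-vertex set contains at most one $5$-subset inducing a $P_5$ or a $\overline{P_5}$. A module of a graph $G=(V,E)$ is a set $M\subseteq V$ such that every vertex outside $M$ is adjacent either to all vertices of $M$ or to none of them. $G$ is prime if its only modules are the trivial ones: $\emptyset$, the singletons, and $V$. *)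

(* Defs.v *)
From mathcomp Require Import all_boot.

Set Implicit Arguments.
Unset Strict Implicit.
Unset Printing Implicit Defensive.

Record sgraph := SGraph {
  vertex :> finType;
  adj : rel vertex;
  adj_sym : symmetric adj;
  adj_irrefl : irreflexive adj
}.

Definition iso (G H : sgraph) : Prop :=
  exists f : G -> H, bijective f /\ {mono f : x y / adj x y}.

Section Constructions.
Variable G : sgraph.

Definition induced_adj (S : {set G}) : rel {x : G | x \in S} :=
  fun x y => adj (val x) (val y).

Lemma induced_sym (S : {set G}) : symmetric (@induced_adj S).
Proof. by move=> x y; apply: adj_sym. Qed.

Lemma induced_irrefl (S : {set G}) : irreflexive (@induced_adj S).
Proof. by move=> x; apply: adj_irrefl. Qed.

Definition induced (S : {set G}) : sgraph :=
  SGraph (@induced_sym S) (@induced_irrefl S).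

Definition compl_adj : rel G := fun x y => (x != y) && ~~ adj x y.

Lemma compl_sym : symmetric compl_adj.
Proof. by move=> x y; rewrite /compl_adj eq_sym adj_sym. Qed.

Lemma compl_irrefl : irreflexive compl_adj.
Proof. by move=> x; rewrite /compl_adj eqxx. Qed.

Definition compl : sgraph := SGraph compl_sym compl_irrefl.

End Constructions.

Definition path_adj (n : nat) : rel 'I_n :=
  fun i j => (i.+1 == j :> nat) || (j.+1 == i :> nat).

Lemma path_sym n : symmetric (@path_adj n).
Proof. by move=> i j; rewrite /path_adj orbC. Qed.

Lemma path_irrefl n : irreflexive (@path_adj n).
Proof. by move=> i; rewrite /path_adj orbb gtn_eqF. Qed.

Definition P5 : sgraph := SGraph (@path_sym 5) (@path_irrefl 5).

Definition C5_adj : rel 'I_5 :=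
  fun i j => (i.+1 == j %[mod 5]) || (j.+1 == i %[mod 5]).

Lemma C5_sym : symmetric C5_adj.
Proof. by move=> i j; rewrite /C5_adj orbC. Qed.

Lemma C5_irrefl : irreflexive C5_adj.
Proof. by case; do 5?[case=> //]. Qed.

Definition C5 : sgraph := SGraph C5_sym C5_irrefl.

Definition induces_member (F : sgraph -> Prop) (G : sgraph) (A : {set G}) :
  Prop := exists H : sgraph, F H /\ iso (induced A) H.

(* Meant for a family F all of whose members have exactly p vertices. *)
Definition sparse (p : nat) (F : sgraph -> Prop) (G : sgraph) : Prop :=
  forall S : {set G}, #|S| = p.+1 ->
  forall A B : {set G},
    A \subset S -> #|A| = p -> induces_member F A ->
    B \subset S -> #|B| = p -> induces_member F B ->
    A = B.

Definition P5_coP5 (H : sgraph) : Prop := H = P5 \/ H = compl P5.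

Definition P5_coP5_sparse (G : sgraph) : Prop := sparse 5 P5_coP5 G.

Definition free (H G : sgraph) : Prop :=
  ~ exists S : {set G}, iso (induced S) H.

Definition is_module (G : sgraph) (M : {set G}) : Prop :=
  forall x : G, x \notin M ->
    (forall y, y \in M -> adj x y) \/ (forall y, y \in M -> ~~ adj x y).

Definition prime_graph (G : sgraph) : Prop :=
  forall M : {set G}, is_module M ->
    M = set0 \/ (exists x, M = [set x]) \/ M = [set: G].

(* Main.v *)
(** By sparsity, a vertex [x] outside an induced C5 is complete to it,
    anticomplete to it, or a (true or false) twin of one of its vertices [v]
    with respect to the rest of the cycle; otherwise [x] and the cycle would
    contain two copies of P5 or of the house. In the last case, replacing [v] by
    [x] gives another induced C5, to which the same trichotomy applies. Hence
    the five classes of twins form a blow-up of C5 which is a module, so it is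
    the whole graph; then each class is a module, so it is a singleton. *)

Require Import Defs.
From mathcomp Require Import all_boot ring.

Set Implicit Arguments.
Unset Strict Implicit.
Unset Printing Implicit Defensive.

(** * Induced copies as injective maps that preserve and reflect adjacency *)

Lemma iso_induced_imset (G H : sgraph) (r : H -> G) :
  injective r -> {mono r : i j / adj i j} -> iso (induced [set r i | i : H]) H.
Proof.
move=> r_inj r_mono.
have r_in i : r i \in [set r i | i : H] by apply: imset_f.
pose g i : induced [set r i | i : H] := exist _ (r i) (r_in i).
have g_inj : injective g by move=> i j /(congr1 val) /r_inj.
have g_bij : bijective g.
  by apply: inj_card_bij => //; rewrite card_sig card_imset.
case: (g_bij) => g' gK g'K; exists g'; split; first by exists g.
by move=> x y; rewrite -{2}[x]g'K -{2}[y]g'K /= /induced_adj /= r_mono.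
Qed.

Lemma induced_iso_mono (G H : sgraph) (S : {set G}) :
  iso (induced S) H -> exists2 r : H -> G, injective r & {mono r : i j / adj i j}.
Proof.
case=> f [[g fK gK] f_mono]; exists (val \o g).
  exact: inj_comp val_inj (can_inj gK).
by move=> i j /=; rewrite -[in RHS](gK i) -[in RHS](gK j) f_mono.
Qed.

(** * Sparsity around an induced C5 *)

Section InducedC5.
Variable G : sgraph.
Implicit Types a b c d e x y z : G.

(* [n = false] encodes P5 and [n = true] its complement. *)
Definition path5 (n : bool) a b c d e :=
  [&& adj a b (+) n, adj b c (+) n, adj c d (+) n, adj d e (+) n,
      ~~ (adj a c (+) n), ~~ (adj a d (+) n), ~~ (adj a e (+) n),
      ~~ (adj b d (+) n), ~~ (adj b e (+) n) & ~~ (adj c e (+) n)].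

Lemma set5_imset (s : seq G) a : size s = 5 ->
  [set x in s] = [set nth a s i | i : 'I_5].
Proof.
move=> s5; apply/setP=> x; rewrite inE; apply/idP/imsetP => [xs|[i _ ->]].
  have lt_i : index x s < 5 by rewrite -s5 index_mem.
  by exists (Ordinal lt_i); rewrite ?nth_index.
by rewrite mem_nth // s5.
Qed.

Lemma path5_induces_member n a b c d e :
  uniq [:: a; b; c; d; e] -> path5 n a b c d e ->
  induces_member P5_coP5 [set x in [:: a; b; c; d; e]].
Proof.
move=> s_uniq s_path.
rewrite (@set5_imset _ a) //; set r := fun i : 'I_5 => _.
have r_inj : injective r.
  by move=> i j /eqP; rewrite /r nth_uniq // => /eqP/val_inj.
(* The diagonal is excluded because [adj (r i) (r i) (+) n] equals [n]. *)
have r_adj i j : i != j -> adj (r i) (r j) (+) n = path_adj i j.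
  wlog lt_ij : i j / i < j.
    move=> wlg ij; case: (ltngtP i j) => [/wlg->//|ji|/val_inj ij'].
      by rewrite adj_sym path_sym wlg // eq_sym.
    by rewrite ij' eqxx in ij.
  case/and5P: s_path => ab bc cd de /and3P[/negPf ac /negPf ad].
  case/and4P=> /negPf ae /negPf bd /negPf be /negPf ce _.
  pose E := (ab, bc, cd, de, (ac, ad, ae, bd, be, ce)).
  case: i j lt_ij => [[|[|[|[|[|i]]]]] lti] [[|[|[|[|[|j]]]]] ltj] //= _;
    by rewrite E.
case: n r_adj {s_path} => r_adj.
  exists (compl P5); split; first by right.
  apply: (@iso_induced_imset _ (compl P5)) r_inj _ => i j.
  have [->|ij] := eqVneq i j; first by rewrite !adj_irrefl.
  by rewrite /= /compl_adj ij /= -(r_adj i j ij) addbT negbK.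
exists P5; split; first by left.
apply: (@iso_induced_imset _ P5) r_inj _ => i j.
have [->|ij] := eqVneq i j; first by rewrite !adj_irrefl.
by rewrite -[LHS]addbF r_adj.
Qed.

Hypothesis G_sparse : P5_coP5_sparse G.

(** Sparsity identifies the two 5-sets of [v] that omit [y] and [z], so [y] lies in neither and must
    be [z]. As [n] and [m] are independent, a P5 can be compared with a house. *)
Lemma path5_missing_eq n m a b c d e a' b' c' d' e' y z (v : seq G) :
  uniq v -> perm_eq v [:: y; a; b; c; d; e] ->
  perm_eq v [:: z; a'; b'; c'; d'; e'] ->
  path5 n a b c d e -> path5 m a' b' c' d' e' -> y = z.
Proof.
set s := [:: a; b; c; d; e]; set t := [:: a'; b'; c'; d'; e'].
move=> v_uniq v_s v_t s_path t_path.
have card_seq (w : seq G) k : uniq w -> size w = k -> #|[set x in w]| = k.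
  by move=> /card_uniqP + <-; rewrite cardsE.
have sub_seq u w : perm_eq v (u :: w) -> [set x in w] \subset [set x in v].
  by move=> v_w; apply/subsetP=> x xw; rewrite inE in xw;
    rewrite inE (perm_mem v_w) inE xw orbT.
have [ys s_uniq] : y \notin s /\ uniq s.
  by apply/andP; rewrite -cons_uniq -(perm_uniq v_s).
have [zt t_uniq] : z \notin t /\ uniq t.
  by apply/andP; rewrite -cons_uniq -(perm_uniq v_t).
have /setP/(_ y) := G_sparse (card_seq _ 6 v_uniq (perm_size v_s))
  (sub_seq _ _ v_s) (card_seq _ 5 s_uniq erefl)
  (path5_induces_member s_uniq s_path)
  (sub_seq _ _ v_t) (card_seq _ 5 t_uniq erefl)
  (path5_induces_member t_uniq t_path).
rewrite !in_set (negPf ys) => y_t; apply/eqP.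
by have := mem_head y s; rewrite -(perm_mem v_s) (perm_mem v_t) inE -y_t orbF.
Qed.

(* As for [path5], [n = true] encodes the complement; since the complement of
   C5 is C5, this reduces the houses to the case of P5. *)
Definition cycle5 (n : bool) a b c d e :=
  [&& adj a b (+) n, adj b c (+) n, adj c d (+) n, adj d e (+) n,
      adj e a (+) n, ~~ (adj a c (+) n), ~~ (adj a d (+) n),
      ~~ (adj b d (+) n), ~~ (adj b e (+) n) & ~~ (adj c e (+) n)].

Lemma cycle5_rot n a b c d e : cycle5 n a b c d e -> cycle5 n b c d e a.
Proof.
rewrite /cycle5 (adj_sym c a) (adj_sym d a).
by case: n; do ![case: (adj _ _) => //=].
Qed.

(** The non-edges of a C5 form the C5 that advances two steps at a time. *)
Lemma cycle5_compl n a b c d e : cycle5 n a b c d e -> cycle5 (~~ n) a c e b d.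
Proof.
rewrite /cycle5 (adj_sym e b) (adj_sym d a) (adj_sym a e) (adj_sym c b).
rewrite (adj_sym e d).
by case: n; do ![case: (adj _ _) => //=].
Qed.

(** The vertex [c] distinguishes [b] from [a]. Irreflexivity would not do so for [n = true], where
    [adj a a (+) n] holds. *)
Lemma cycle5_neq01 n a b c d e : cycle5 n a b c d e -> a != b.
Proof.
apply: contraTneq => <-; rewrite /cycle5.
by case: n; do ![case: (adj _ _) => //=].
Qed.

Lemma cycle5_neq02 n a b c d e : cycle5 n a b c d e -> a != c.
Proof. by move/cycle5_compl/cycle5_neq01. Qed.

Lemma cycle5_uniq n a b c d e : cycle5 n a b c d e -> uniq [:: a; b; c; d; e].
Proof.
move=> C0; have C1 := cycle5_rot C0; have C2 := cycle5_rot C1.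
have C3 := cycle5_rot C2; have C4 := cycle5_rot C3.
rewrite /= !inE !negb_or (eq_sym a d) (eq_sym a e) (eq_sym b e).
rewrite (cycle5_neq01 C0) (cycle5_neq01 C1) (cycle5_neq01 C2).
rewrite (cycle5_neq01 C3) (cycle5_neq01 C4) (cycle5_neq02 C0).
by rewrite (cycle5_neq02 C1) (cycle5_neq02 C2) (cycle5_neq02 C3) (cycle5_neq02 C4).
Qed.

(* For [n = false], [x] starts the paths [x a e d c] and either [x a b c d] or
   [x b c d e]. *)
Lemma cycle5_no_pendant n a b c d e x :
    cycle5 n a b c d e -> x \notin [:: a; b; c; d; e] ->
  ~~ [&& adj x a (+) n, ~~ (adj x c (+) n), ~~ (adj x d (+) n)
       & ~~ (adj x e (+) n)].
Proof.
move=> C xC; apply/negP => /and4P[xa xc xd xe].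
have v_uniq : uniq [:: x; a; b; c; d; e] by rewrite cons_uniq xC (cycle5_uniq C).
have p1 : path5 n x a e d c.
  move: C; rewrite /path5 /cycle5 xa xc xd xe.
  rewrite (adj_sym a e) (adj_sym e d) (adj_sym d c) (adj_sym e c).
  by case: n {xa xc xd xe}; do ![case: (adj _ _) => //=].
have p2 : if adj x b (+) n then path5 n x b c d e else path5 n x a b c d.
  move: C; rewrite /path5 /cycle5 xa xc xd xe.
  by case: (adj x b (+) n); case: n {xa xc xd xe p1}; do ![case: (adj _ _) => //=].
(* The path [p1] misses [b], while [p2] misses [a] or [e]; sparsity would make the missed vertices
   equal. *)
have b_neq : b != e /\ b != a.
  split; last by rewrite eq_sym (cycle5_neq01 C).
  by rewrite eq_sym (cycle5_neq02 (cycle5_rot (cycle5_rot (cycle5_rot (cycle5_rot C))))).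
have v_b : perm_eq [:: x; a; b; c; d; e] [:: b; x; a; e; d; c].
  (* [permP] leaves an equality between two sums of the same counts. *)
  by apply/permP=> p /=; ring.
case: ifP p2 b_neq => _ p2 [be ba].
  have v_a : perm_eq [:: x; a; b; c; d; e] [:: a; x; b; c; d; e].
    by apply/permP=> p /=; ring.
  by rewrite (path5_missing_eq v_uniq v_b v_a p1 p2) eqxx in ba.
have v_e : perm_eq [:: x; a; b; c; d; e] [:: e; x; a; b; c; d].
  by apply/permP=> p /=; ring.
by rewrite (path5_missing_eq v_uniq v_b v_e p1 p2) eqxx in be.
Qed.

(* [adj x a] is left free: [a] itself and its true and false twins qualify. *)
Definition twin a b c d e x := [&& adj x b, adj x e, ~~ adj x c & ~~ adj x d].

Definition complete a b c d e x :=
  [&& adj x a, adj x b, adj x c, adj x d & adj x e].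

Definition anticomplete a b c d e x :=
  ~~ [|| adj x a, adj x b, adj x c, adj x d | adj x e].

Definition twin_any a b c d e x :=
  [|| twin a b c d e x, twin b c d e a x, twin c d e a b x,
      twin d e a b c x | twin e a b c d x].

Lemma cycle5_self_twin a b c d e :
  cycle5 false a b c d e -> twin a b c d e a.
Proof.
by rewrite /cycle5 /twin (adj_sym e a); do ![case: (adj _ _) => //=].
Qed.

(** A vertex of the cycle is its own twin. For any other [x], [cycle5_no_pendant] is applied to all
    rotations of the cycle and of its complement. *)
Lemma cycle5_trichotomy a b c d e x : cycle5 false a b c d e ->
  [|| complete a b c d e x, anticomplete a b c d e x | twin_any a b c d e x].
Proof.
move=> C0; have C1 := cycle5_rot C0; have C2 := cycle5_rot C1.
have C3 := cycle5_rot C2; have C4 := cycle5_rot C3.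
have [|xC] := boolP (x \in [:: a; b; c; d; e]).
  rewrite /twin_any !inE.
  by case/or4P=> [/eqP->|/eqP->|/eqP->|/orP[]/eqP->];
    rewrite (cycle5_self_twin C0, cycle5_self_twin C1, cycle5_self_twin C2,
             cycle5_self_twin C3, cycle5_self_twin C4) ?orbT.
have no_pendant n a' b' c' d' e' : cycle5 n a' b' c' d' e' ->
    {subset [:: a'; b'; c'; d'; e'] <= [:: a; b; c; d; e]} ->
  ~~ [&& adj x a' (+) n, ~~ (adj x c' (+) n), ~~ (adj x d' (+) n)
       & ~~ (adj x e' (+) n)].
  by move=> C sub_C; apply: (cycle5_no_pendant C); apply: contra xC => /sub_C.
(* The second condition is the first one read in the complementary cycle [a' c' e' b' d']. *)
have {}no_pendant a' b' c' d' e' : cycle5 false a' b' c' d' e' ->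
    {subset [:: a'; b'; c'; d'; e'] <= [:: a; b; c; d; e]} ->
  ~~ [&& adj x a', ~~ adj x c', ~~ adj x d' & ~~ adj x e'] /\
  ~~ [&& ~~ adj x a', adj x e', adj x b' & adj x d'].
  move=> C sub_C; have := no_pendant _ _ _ _ _ _ C sub_C.
  have sub_C' : {subset [:: a'; c'; e'; b'; d'] <= [:: a; b; c; d; e]}.
    by move=> y y_C; apply: sub_C; move: y_C; rewrite !inE; do 5![case: (_ == _)].
  have := no_pendant _ _ _ _ _ _ (cycle5_compl C) sub_C'.
  by rewrite !addbT !addbF !negbK.
have sub_rot k : {subset rot k [:: a; b; c; d; e] <= [:: a; b; c; d; e]}.
  by move=> y; rewrite mem_rot.
(* Two exclusions per rotation settle the 32 possible neighbourhoods of [x] on the cycle. *)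
case: (no_pendant _ _ _ _ _ C0 (sub_rot 0)) => /negPf + /negPf +.
case: (no_pendant _ _ _ _ _ C1 (sub_rot 1)) => /negPf + /negPf +.
case: (no_pendant _ _ _ _ _ C2 (sub_rot 2)) => /negPf + /negPf +.
case: (no_pendant _ _ _ _ _ C3 (sub_rot 3)) => /negPf + /negPf +.
case: (no_pendant _ _ _ _ _ C4 (sub_rot 4)) => /negPf + /negPf +.
rewrite /complete /anticomplete /twin_any /twin.
by do 5![case: (adj x _)].
Qed.

Lemma cycle5_twin a b c d e x :
  cycle5 false a b c d e -> twin a b c d e x -> cycle5 false x b c d e.
Proof.
by rewrite /cycle5 /twin (adj_sym e x); do ![case: (adj _ _) => //=].
Qed.

(** By the trichotomy [z] is complete or anticomplete to the old cycle. The shared vertices [b],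
    [c], [d], [e] then force the same case for the cycle through [x]. *)
Lemma twin_adj_outside a b c d e x z : cycle5 false a b c d e ->
  twin a b c d e x -> ~~ twin_any a b c d e z -> adj z x = adj z b.
Proof.
move=> C xa; have := cycle5_trichotomy z C.
have := cycle5_trichotomy z (cycle5_twin C xa).
rewrite /complete /anticomplete /twin_any /twin.
by do 6![case: (adj z _)].
Qed.

(** On the cycle [x b c d e], [y] sees [c] but neither [d] nor [e]; the trichotomy leaves only a
    twin of [b]. *)
Lemma twin_adj_next a b c d e x y : cycle5 false a b c d e ->
  twin a b c d e x -> twin b c d e a y -> adj y x.
Proof.
move=> C xa; have := cycle5_trichotomy y (cycle5_twin C xa).
rewrite /complete /anticomplete /twin_any /twin.
by do 6![case: (adj y _)].
Qed.

(** On the cycle [x b c d e], [y] sees [b] and [d] but not [e]; the trichotomy leaves only a twin of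
    [c]. *)
Lemma twin_nadj a b c d e x y : cycle5 false a b c d e ->
  twin a b c d e x -> twin c d e a b y -> ~~ adj y x.
Proof.
move=> C xa; have := cycle5_trichotomy y (cycle5_twin C xa).
rewrite /complete /anticomplete /twin_any /twin.
by do 6![case: (adj y _)].
Qed.

(** * Primality: the twin classes cover the graph and are singletons *)

Hypothesis G_prime : prime_graph G.

Lemma twin_any_rot a b c d e x :
  twin_any a b c d e x = twin_any b c d e a x.
Proof. by rewrite /twin_any [LHS]orbC -!orbA. Qed.

Lemma cycle5_spanning a b c d e x : cycle5 false a b c d e -> twin_any a b c d e x.
Proof.
move=> C0; have C1 := cycle5_rot C0; have C2 := cycle5_rot C1.
have C3 := cycle5_rot C2; have C4 := cycle5_rot C3.
have self_a := cycle5_self_twin C0; have self_b := cycle5_self_twin C1.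
have ab := cycle5_neq01 C0.
suff M_mod : is_module [set y | twin_any a b c d e y].
  case: (G_prime M_mod) => [/setP/(_ a)|[[y M_y]|/setP/(_ x)]].
  - by rewrite !inE /twin_any self_a.
  - have a_y : a = y by apply/set1P; rewrite -M_y inE /twin_any self_a.
    have b_y : b = y by apply/set1P; rewrite -M_y inE /twin_any self_b orbT.
    by rewrite a_y b_y eqxx in ab.
  - by rewrite !inE.
move=> z; rewrite inE => zM0.
have zM1 := zM0; rewrite twin_any_rot in zM1; have zM2 := zM1; rewrite twin_any_rot in zM2.
have zM3 := zM2; rewrite twin_any_rot in zM3; have zM4 := zM3; rewrite twin_any_rot in zM4.
have z_C : complete a b c d e z \/ anticomplete a b c d e z.
  by have := cycle5_trichotomy z C0; rewrite (negPf zM0) orbF => /orP.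
(* Whichever class contains [y], [adj z y] equals the adjacency of [z] to some cycle vertex, and
   these five values agree. *)
have adj_zy y : twin_any a b c d e y -> adj z y = adj z a.
  move=> y_M; have : adj z y \in [:: adj z a; adj z b; adj z c; adj z d; adj z e].
    case/or4P: y_M => [yM|yM|yM|/orP[]yM].
    - by rewrite (twin_adj_outside C0 yM zM0) !inE eqxx ?orbT.
    - by rewrite (twin_adj_outside C1 yM zM1) !inE eqxx ?orbT.
    - by rewrite (twin_adj_outside C2 yM zM2) !inE eqxx ?orbT.
    - by rewrite (twin_adj_outside C3 yM zM3) !inE eqxx ?orbT.
    - by rewrite (twin_adj_outside C4 yM zM4) !inE eqxx ?orbT.
  move: z_C; rewrite /complete /anticomplete !inE.
  by do 6![case: (adj z _)] => //=; case.
by case: z_C => z_C; [left|right] => y; rewrite inE => /adj_zy->;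
  move: z_C; rewrite /complete /anticomplete; case: (adj z a).
Qed.

Lemma cycle5_twin_eq a b c d e x :
  cycle5 false a b c d e -> twin a b c d e x -> x = a.
Proof.
move=> C0; have C1 := cycle5_rot C0; have C2 := cycle5_rot C1.
have C3 := cycle5_rot C2; have C4 := cycle5_rot C3.
have self_a := cycle5_self_twin C0; move=> self_x.
suff M_mod : is_module [set y | twin a b c d e y].
  case: (G_prime M_mod) => [/setP/(_ a)|[[y M_y]|/setP/(_ b)]].
  - by rewrite !inE self_a.
  - have -> : a = y by apply/set1P; rewrite -M_y inE.
    by apply/set1P; rewrite -M_y inE.
  - by rewrite !inE /twin adj_irrefl.
move=> z; rewrite inE => /negPf za; have := cycle5_spanning z C0.
(* The twins of [b] and [e] are complete to the class of [a], those of [c] and [d] anticomplete. For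
   [d] and [e], the cycle is rotated so that [a] comes after them and the two vertices swap
   roles. *)
rewrite /twin_any za /= => /or4P[] zM; [left|right|right|left] => y; rewrite inE => yM.
- exact: twin_adj_next C0 yM zM.
- exact: twin_nadj C0 yM zM.
- by rewrite adj_sym; apply: twin_nadj C3 zM yM.
- by rewrite adj_sym; apply: twin_adj_next C4 zM yM.
Qed.

Lemma cycle5_all a b c d e x :
  cycle5 false a b c d e -> x \in [:: a; b; c; d; e].
Proof.
move=> C0; have C1 := cycle5_rot C0; have C2 := cycle5_rot C1.
have C3 := cycle5_rot C2; have C4 := cycle5_rot C3; rewrite !inE.
case/or4P: (cycle5_spanning x C0) => [xM|xM|xM|/orP[]xM].
- by rewrite (cycle5_twin_eq C0 xM) eqxx.
- by rewrite (cycle5_twin_eq C1 xM) eqxx ?orbT.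
- by rewrite (cycle5_twin_eq C2 xM) eqxx ?orbT.
- by rewrite (cycle5_twin_eq C3 xM) eqxx ?orbT.
- by rewrite (cycle5_twin_eq C4 xM) eqxx ?orbT.
Qed.

End InducedC5.

Theorem theorem2p1 (G : sgraph) (hprime : prime_graph G)
    (hsparse : P5_coP5_sparse G) :
  free C5 G \/ iso G C5.
Proof.
(* Ranging over finite functions makes the existence of an induced C5 a boolean, so the case split
   is constructive. *)
case: (boolP [exists r : {ffun C5 -> G}, injectiveb r &&
          [forall i, [forall j, adj (r i) (r j) == adj i j]]]); last first.
  move=> noC5; left=> -[S /induced_iso_mono[r r_inj r_mono]].
  case/negP: noC5; apply/existsP; exists (finfun r); apply/andP; split.
    by apply/injectiveP => i j; rewrite !ffunE; apply: r_inj.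
  by apply/forallP=> i; apply/forallP=> j; rewrite !ffunE r_mono.
case/existsP=> r /andP[/injectiveP r_inj /forallP r_mono]; right.
have {}r_mono i j : adj (r i) (r j) = adj i j.
  by have /forallP/(_ j)/eqP := r_mono i.
pose v k : C5 := @inord 4 k.
have C : cycle5 false (r (v 0)) (r (v 1)) (r (v 2)) (r (v 3)) (r (v 4)).
  by rewrite /cycle5 !r_mono /= /C5_adj !inordK.
(* The cycle contains every vertex, so the embedding of C5 is onto and can be inverted by choice. *)
have r_surj x : exists i, r i == x.
  have := cycle5_all hsparse hprime x C.
  by rewrite !inE => /or4P[|||/orP[]] /eqP->; eexists; apply: eqxx.
pose r' x := xchoose (r_surj x).
have r'K : cancel r' r by move=> x; apply/eqP/(xchooseP (r_surj x)).
have rK : cancel r r' by move=> i; apply: r_inj; rewrite r'K.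
by exists r'; split=> [|x y]; [exists r | rewrite -r_mono !r'K].
Qed.
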